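(* Let $m\ge 2$, $n\ge 1$ and let $P(z)=A_0+A_1z+\cdots+A_{m-1}z^{m-1}+Iz^m$ be a monic matrix polynomial with $A_i\in\mathbb{C}^{n\times n}$. Denote $$\alpha:=\max_{i=0,\ldots,m-2}\|A_i\|.$$ Then each eigenvalue $\lambda$ of $P(z)$ satisfies $$|\lambda|\le\frac12\left\{1+\|A_{m-1}\|+\left[\left(1-\|A_{m-1}\|\right)^2+4\alpha\right]^{1/2}\right\}.$$
   Context: A number $\lambda\in\mathbb{C}$ is an eigenvalue of the matrix polynomial $P(z)$ if there is a nonzero vector $x\in\mathbb{C}^n$ with $P(\lambda)x=0$. $I$ is the $n\times n$ identity matrix. $\|\cdot\|$ denotes a subordinate matrix norm, i.e. the operator norm on $\mathbb{C}^{n\times n}$ induced by an arbitrary fixed vector norm on $\mathbb{C}^n$. *)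

(* Defs.v *)
From HB Require Import structures.
From mathcomp Require Import all_boot all_order all_algebra.
From mathcomp Require Import complex.
From mathcomp Require Import all_classical all_reals.

Set Implicit Arguments.
Unset Strict Implicit.
Unset Printing Implicit Defensive.

Import Order.TTheory GRing.Theory Num.Theory.

Local Open Scope ring_scope.
Local Open Scope classical_set_scope.

(* The modulus of a complex number as an element of R; the library norm
   `|z| is the same number injected into R[i]. *)
Notation cabs := ComplexField.Normc.normc.

Definition vector_norm (R : realType) (n : nat) (N : 'cV[R[i]]_n -> R) : Prop :=
  [/\ forall x, 0 <= N x,
      forall x, N x = 0 <-> x = 0,
      forall (a : R[i]) x, N (a *: x) = cabs a * N x &
      forall x y, N (x + y) <= N x + N y].

(* When N is a norm and 0 < n, this set is nonempty and bounded, so sup does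
   not take its default value. *)
Definition opnorm (R : realType) (n : nat) (N : 'cV[R[i]]_n -> R)
    (A : 'M[R[i]]_n) : R :=
  sup [set N (A *m x) | x in [set x | N x = 1]].

(* In the ring {poly 'M_n.+1} the indeterminate is evaluated at matrices;
   evaluating at the scalar matrix lam%:M, which commutes with every
   coefficient, gives P(lam) = \sum_i lam ^+ i *: P`_i. *)
Definition mxpoly_eigenvalue (F : fieldType) (n : nat)
    (P : {poly 'M[F]_n.+1}) (lam : F) : Prop :=
  exists2 x : 'cV[F]_n.+1, x != 0 & P.[lam%:M] *m x = 0.

(* Main.v *)
Require Import Defs.
From mathcomp Require Import all_boot all_order all_algebra.
From mathcomp Require Import complex.
From mathcomp Require Import all_classical all_reals.
From mathcomp Require Import topology normedtype derive.
From mathcomp Require Import lra.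

Import Order.TTheory GRing.Theory Num.Theory.
Import numFieldNormedType.Exports.

Local Open Scope ring_scope.

(** Let [x] be an eigenvector for [lam], r = |lam| and a = ||A_(m-1)||. Solving
    P(lam) x = 0 for the leading term gives
    lam^m x = - sum_(i < m) lam^i A_i x ([eigenvalue_recurrence]). Taking norms,
    using N (A x) <= ||A|| N x ([opnorm_le]), and dividing by N x > 0 yields
      r^m <= a r^(m-1) + alpha (1 + r + ... + r^(m-2)).
    For r > 1 the geometric sum is less than r^(m-1) / (r - 1), whence
    (r - 1) (r - a) <= alpha: r lies below the larger root of a quadratic, and
    this root is the bound. For r <= 1 there is nothing to do, because that
    root is at least 1 ([le_larger_quadratic_root]).

    The analytic content is in [opnorm_le]: since [opnorm] is a supremum over
    the unit sphere of an arbitrary norm, it must be shown that linear maps are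
    bounded on that sphere. This follows from the comparison with the sup norm
    ([real_norm_ge_sup_norm]), a compactness argument. *)

Lemma entry_le_sup_norm (R : realType) (k : nat) (v : 'rV[R]_k) j :
  `|v 0 j| <= `|v|.
Proof.
rewrite [leRHS]mx_normrE.
exact: (le_bigmax _ (fun ij : 'I_1 * 'I_k => `|v ij.1 ij.2|) (0, j)).
Qed.

(** Half of the equivalence of norms in finite dimension. Subadditivity and
    homogeneity make [f] Lipschitz for the sup norm, hence continuous; on the
    sup-norm unit sphere, which is compact, it attains a minimum, positive
    because [f] is definite, and homogeneity spreads this minimum to all
    vectors. *)
Lemma real_norm_ge_sup_norm (R : realType) (k : nat) (f : 'rV[R]_k -> R)
    (f_ge0 : forall v, 0 <= f v)
    (f_eq0 : forall v, f v = 0 -> v = 0)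
    (fZ : forall a v, f (a *: v) = `|a| * f v)
    (fD : forall v w, f (v + w) <= f v + f w) :
  exists2 c : R, 0 < c & forall v, c * `|v| <= f v.
Proof.
have f0 : f 0 = 0 by rewrite -(scale0r 0) fZ normr0 mul0r.
have fN v : f (- v) = f v by rewrite -scaleN1r fZ normrN1 mul1r.
(* The summand 1 keeps [M] positive even when all the others vanish. *)
pose M := 1 + \sum_(j < k) f (delta_mx 0 j).
have M_gt0 : 0 < M by apply: ltr_pwDl => //; apply: sumr_ge0.
have f_le v : f v <= M * `|v|.
  rewrite {1}[v]row_sum_delta.
  apply: (@le_trans _ _ (\sum_j f (v 0 j *: delta_mx 0 j))).
    elim/big_ind2: _ => [|x1 x2 y1 y2 h1 h2|//]; first by rewrite f0.
    exact: le_trans (fD _ _) (lerD h1 h2).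
  rewrite mulrDl mul1r mulr_suml ler_wpDl// ler_sum// => j _.
  rewrite fZ mulrC ler_wpM2l//.
  exact: entry_le_sup_norm.
have f_lip v w : `|f v - f w| <= M * `|v - w|.
  have sub a b : f a - f b <= f (a - b) by rewrite lerBlDr -{1}[a](subrK b).
  apply: le_trans (f_le _); rewrite ler_norml sub andbT.
  by rewrite lerNl opprB -[leRHS]fN opprB.
have f_cont : continuous f.
  move=> v; apply/(@cvgrPdist_lt _ _ _ _ (nbhs_filter v)) => e e_gt0.
  apply: (iffRL (@nbhs_normP R 'rV[R]_k v _)); exists (e / M); first exact: divr_gt0.
  move=> w /= vw_lt; apply: le_lt_trans (f_lip v w) _.
  by rewrite mulrC -ltr_pdivlMr.
pose S := [set v : 'rV[R]_k | `|v| = 1]%classic.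
have scale_S v : v != 0 -> S (`|v|^-1 *: v).
  by move=> v_neq0; rewrite /S /= normrZ normfV normr_id mulVf ?normr_eq0.
have S_compact : compact S.
  apply: bounded_closed_compact.
    by exists 1; split=> // x x_gt1 v /= ->; apply: ltW.
  rewrite (_ : S = Num.norm @^-1` [set 1])%classic//.
  by apply: preimage_closed; [move=> v _; exact: norm_continuous|exact: closed_eq].
have [S0|S_nempty] := pselect (S = set0)%classic.
  (* The sphere is empty only in dimension 0, where every vector is 0. *)
  exists 1 => // v; have [->|v_neq0] := eqVneq v 0.
    by rewrite normr0 mulr0.
  by have := scale_S _ v_neq0; rewrite S0.
have /set0P S_ne : (S != set0)%classic by apply/eqP.
have [u uS u_min] := EVT_min_rV S_ne S_compact (continuous_subspaceT f_cont).
move: uS; rewrite inE /S /= => u1.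
exists (f u).
  rewrite lt_def f_ge0 andbT; apply/negP => /eqP /f_eq0 u0.
  by move: u1; rewrite u0 normr0 => /eqP; rewrite eq_sym oner_eq0.
move=> v; have [->|v_neq0] := eqVneq v 0; first by rewrite normr0 mulr0.
have := u_min (`|v|^-1 *: v); rewrite inE => /(_ (scale_S _ v_neq0)).
by rewrite fZ normfV normr_id ler_pdivlMl ?normr_gt0// mulrC.
Qed.

Section VectorNorm.
Variables (R : realType) (n : nat) (N : 'cV[R[i]]_n -> R).
Hypothesis hN : vector_norm N.

Let N_ge0 x : 0 <= N x. Proof. by case: hN. Qed.
Let N_eq0 x : N x = 0 -> x = 0. Proof. by case: hN => _ h _ _ /h. Qed.
Let NZ a x : N (a *: x) = cabs a * N x. Proof. by case: hN. Qed.
Let ND x y : N (x + y) <= N x + N y. Proof. by case: hN. Qed.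
Let N0 : N 0 = 0. Proof. by case: hN => _ h _ _; apply/h. Qed.

Lemma vector_norm_sum I (r : seq I) (F : I -> 'cV[R[i]]_n) :
  N (\sum_(j <- r) F j) <= \sum_(j <- r) N (F j).
Proof.
elim/big_ind2: _ => [|x1 x2 y1 y2 h1 h2|//]; first by rewrite N0.
exact: le_trans (ND _ _) (lerD h1 h2).
Qed.

Lemma cabs_real (a : R) : cabs (a%:C)%C = `|a|.
Proof. by rewrite /= expr0n/= addr0 sqrtr_sqr. Qed.

Lemma cabs_le_ReIm (z : R[i]) : cabs z <= `|complex.Re z| + `|complex.Im z|.
Proof.
case: z => a b /=; rewrite -[leRHS]ger0_norm ?addr_ge0// -sqrtr_sqr.
apply: ler_wsqrtr.
by rewrite sqrrD !real_normK ?num_real// addrAC lerDl mulrn_wge0// mulr_ge0.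
Qed.

(** Reading a complex column vector as the real row vector of its real and
    imaginary parts turns [N] into a real norm on R^(2n), to which
    [real_norm_ge_sup_norm] applies. *)
Lemma entries_bounded_by_norm :
  exists2 K : R, 0 <= K & forall (x : 'cV[R[i]]_n) j, cabs (x j 0) <= K * N x.
Proof.
pose cvec (v : 'rV[R]_(n + n)) : 'cV[R[i]]_n :=
  \col_j (lsubmx v 0 j +i* rsubmx v 0 j)%C.
have cvecZ a v : cvec (a *: v) = (a%:C)%C *: cvec v.
  by apply/colP => j; rewrite !mxE; simpc.
have cvecD v w : cvec (v + w) = cvec v + cvec w.
  by apply/colP => j; rewrite !mxE; simpc.
have [|v /N_eq0 /colP v0|a v|v w|c c_gt0 cP] :=
  @real_norm_ge_sup_norm R (n + n) (N \o cvec).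
- by move=> v; apply: N_ge0.
- apply/rowP => j; rewrite mxE -(fintype.splitK j).
  by case: (fintype.split j) => l /=; have := v0 l; rewrite !mxE => -[? ?].
- by rewrite /= cvecZ NZ cabs_real.
- by rewrite /= cvecD ND.
exists (2 / c) => [|x j]; first by rewrite divr_ge0// ltW.
pose v := row_mx (\row_l complex.Re (x l 0)) (\row_l complex.Im (x l 0)).
have xE : cvec v = x.
  apply/colP => l; rewrite mxE row_mxKl row_mxKr !mxE.
  by case: (x l 0).
rewrite mulrAC ler_pdivlMr// mulrC.
apply: le_trans (_ : c * (2 * `|v|) <= _); last first.
  by rewrite mulrCA ler_pM2l// -xE; exact: cP.
rewrite ler_pM2l//; apply: le_trans (cabs_le_ReIm _) _.
rewrite mulr_natl mulr2n lerD//.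
  by have := entry_le_sup_norm _ _ v (lshift n j); rewrite row_mxEl mxE.
by have := entry_le_sup_norm _ _ v (rshift n j); rewrite row_mxEr mxE.
Qed.

(** The supremum in [opnorm] controls [N (A *m x)] only if it is taken over a
    bounded set; boundedness comes from expanding [A *m x] along the columns
    of [A], since the entries of [x] are bounded on the unit sphere of [N]. *)
Lemma opnorm_le (A : 'M[R[i]]_n) x : N (A *m x) <= opnorm N A * N x.
Proof.
have [K K_ge0 KP] := entries_bounded_by_norm.
pose B := \sum_(j < n) K * N (col j A).
have AB y : N y = 1 -> N (A *m y) <= B.
  move=> y1; have -> : A *m y = \sum_j y j 0 *: col j A.
    apply/colP => l; rewrite mxE summxE; apply: eq_bigr => j _.
    by rewrite !mxE mulrC.
  apply: le_trans (vector_norm_sum _ _ _) _; apply: ler_sum => j _.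
  by rewrite NZ ler_wpM2r// -[leRHS]mulr1 -y1 KP.
have [->|x_neq0] := eqVneq x 0; first by rewrite mulmx0 N0 mulr0.
have Nx_neq0 : N x != 0 by apply: contra x_neq0 => /eqP /N_eq0 ->.
have Nx_gt0 : 0 < N x by rewrite lt_def Nx_neq0 N_ge0.
pose u := ((N x)^-1%:C)%C *: x.
have u1 : N u = 1.
  by rewrite NZ cabs_real ger0_norm ?invr_ge0// mulVf.
have : N (A *m u) <= opnorm N A.
  apply: ub_le_sup; last by exists u.
  by exists B => _ [y y1 <-]; apply: AB.
by rewrite -scalemxAr NZ cabs_real ger0_norm ?invr_ge0// ler_pdivrMl// mulrC.
Qed.

End VectorNorm.

(** The right-hand side is the larger root of t^2 - (1 + a) t + (a - alpha),
    which is (t - 1) (t - a) - alpha. If r <= 1, it suffices that this root is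
    at least (1 + a + |1 - a|) / 2 >= 1. If r > 1, multiplying the hypothesis
    by r - 1 collapses the geometric sum; dropping the nonpositive term - alpha
    and dividing by r^m leaves (r - 1) (r - a) <= alpha, so r is at most the
    larger root. *)
Lemma le_larger_quadratic_root (R : rcfType) (m : nat) (r a alpha : R) :
  0 <= r -> 0 <= alpha ->
  r ^+ m.+1 <= a * r ^+ m + alpha * \sum_(i < m) r ^+ i ->
  r <= 2^-1 * (1 + a + Num.sqrt ((1 - a) ^+ 2 + 4 * alpha)).
Proof.
move=> r_ge0 alpha_ge0 r_le.
set D := (1 - a) ^+ 2 + 4 * alpha.
suff : 2 * r - (1 + a) <= Num.sqrt D by lra.
have [r_le1|r_gt1] := leP r 1.
  apply: le_trans (_ : Num.sqrt ((1 - a) ^+ 2) <= _); last first.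
    by apply: ler_wsqrtr; rewrite lerDl mulr_ge0.
  by rewrite sqrtr_sqr; apply: le_trans (ler_norm _); lra.
have rm_gt0 : 0 < r ^+ m by rewrite exprn_gt0// (lt_trans ltr01).
have quad : r * (r - 1) <= a * (r - 1) + alpha.
  rewrite -(ler_pM2l rm_gt0).
  have := ler_wpM2r (_ : 0 <= r - 1) r_le; rewrite subr_ge0 => /(_ (ltW r_gt1)).
  rewrite exprSr mulrDl -!mulrA [_ * (r - 1) in X in _ <= _ + X]mulrC -subrX1.
  by move: rm_gt0; set p := r ^+ m => p_gt0 h; apply: le_trans h _; nra.
rewrite -[leRHS]ger0_norm ?sqrtr_ge0//; apply: le_trans (ler_norm _) _.
rewrite -ler_sqr ?nnegrE// !real_normK ?num_real// sqr_sqrtr; last first.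
  by rewrite addr_ge0 ?sqr_ge0// mulr_ge0.
rewrite /D; nra.
Qed.

(** [P] is evaluated in the ring of matrices at a scalar matrix, so its value
    acts on [x] by scalar powers of [lam]; the leading term is isolated because
    its coefficient is the identity. *)
Lemma eigenvalue_recurrence (F : comNzRingType) (m n : nat)
    (P : {poly 'M[F]_n.+1}) (lam : F) (x : 'cV[F]_n.+1) :
  P \is monic -> size P = m.+1 -> P.[lam%:M] *m x = 0 ->
  lam ^+ m *: x = - \sum_(i < m) lam ^+ i *: (P`_i *m x).
Proof.
move=> P_monic sizeP; rewrite horner_coef sizeP big_ord_recr/=.
have -> : P`_m = 1 by move/monicP: P_monic; rewrite lead_coefE sizeP.
rewrite mul1r mulmxDl mulmx_suml => /eqP; rewrite addrC addr_eq0.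
have lamX i : (lam%:M : 'M[F]_n.+1) ^+ i = (lam ^+ i)%:M.
  by elim: i => [|i IHi]; rewrite ?expr0 ?idmxE // !exprS IHi -mulmxE -scalar_mxM.
rewrite lamX mul_scalar_mx => /eqP ->; congr (- _); apply: eq_bigr => i _.
by rewrite lamX -mulmxE mul_mx_scalar scalemxAl.
Qed.

Theorem theorem3p6 (R : realType) (m n : nat) (hm : (2 <= m)%N)
    (N : 'cV[R[i]]_n.+1 -> R) (hN : vector_norm N)
    (P : {poly 'M[R[i]]_n.+1}) (hP : P \is monic) (hdeg : size P = m.+1)
    (lam : R[i]) (hlam : mxpoly_eigenvalue P lam) :
  let alpha := \big[Num.max/0]_(i < m.-1) opnorm N P`_i in
  cabs lam <=
    2^-1 * (1 + opnorm N P`_m.-1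
              + Num.sqrt ((1 - opnorm N P`_m.-1) ^+ 2 + 4 * alpha)).
Proof.
case: m hm hdeg => // m _ hdeg /=.
set alpha := \big[Num.max/0]_(i < m) _.
have [N_ge0 N_eq0 NZ ND] := hN.
case: hlam => x x_neq0 /(eigenvalue_recurrence _ _ _ _ _ _ hP hdeg) lamx.
have Nx_gt0 : 0 < N x.
  by rewrite lt_def N_ge0 andbT; apply: contra x_neq0 => /eqP /N_eq0 ->.
have cabsX i : cabs (lam ^+ i) = cabs lam ^+ i.
  elim: i => [|i IHi]; first by rewrite !expr0 ComplexField.Normc.normc1.
  by rewrite !exprS ComplexField.Normc.normcM IHi.
have cabs_ge0 : 0 <= cabs lam by case: (lam) => ? ?; apply: sqrtr_ge0.
apply: (@le_larger_quadratic_root _ m) => //; first exact: bigmax_ge_id.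
rewrite -(ler_pM2r Nx_gt0) -cabsX -NZ lamx.
have -> y : N (- y) = N y.
  by rewrite -scaleN1r -(rmorphN1 (real_complex R)) NZ cabs_real normrN1 mul1r.
rewrite big_ord_recr/= addrC mulrDl.
have term_le i : N (lam ^+ i *: (P`_i *m x)) <= opnorm N P`_i * cabs lam ^+ i * N x.
  by rewrite NZ cabsX mulrAC mulrC ler_wpM2r ?exprn_ge0 ?opnorm_le.
apply: le_trans (ND _ _) _; apply: lerD => //.
apply: le_trans (vector_norm_sum _ _ _ hN _ _ _) _.
rewrite mulr_sumr mulr_suml; apply: ler_sum => i _.
apply: le_trans (term_le i) _; rewrite ler_wpM2r// ler_wpM2r ?exprn_ge0//.
exact: (le_bigmax _ (fun i : 'I_m => opnorm N P`_i)).
Qed.
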